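(* For a fixed real number $x_0$, consider the evaluation map which sends each vertex of the backward tree (a rational function of $x$) to its value at $x=x_0$. Then: (1) For every real $x_0\geq 1$, the evaluation map at $x_0$ is injective on the set of vertices of the backward tree, and its image is a dense subset of $(0,1)$. For every $x_0\in(0,1)$, the evaluation map at $x_0$ is injective and its image is a subset of $(0,1)$, but the image is not dense in $(0,1)$. (2) For real $x_0\geq 1$, the evaluation map at $x_0$ is a bijection from the set of vertices of the backward tree onto $\mathbb{Q}\cap(0,1)$ if and only if $x_0\in\mathbb{Z}^+$.
   Context: The backward tree (backward Farey tree) is the infinite rooted binary tree whose nodes (vertices) carry rational functions $p(x)/q(x)$, whose root is $\frac{1}{x+1}$, and where the node carrying $p/q$ has two children $$\Phi_0\left(\frac{p(x)}{q(x)}\right)=\frac{(x-1)p(x)+q(x)}{(x+1)q(x)-p(x)},\qquad \Phi_1\left(\frac{p(x)}{q(x)}\right)=\frac{p(x)}{x\,q(x)+p(x)},$$ with fractions simplified (common polynomial factors cancelled). Injectivity means that distinct nodes of the binary tree give distinct values. $\mathbb{Z}^+$ is the set of positive integers. *)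

(* Defs.v *)
From HB Require Import structures.
From mathcomp Require Import all_boot all_order all_algebra.
From mathcomp Require Import all_classical all_reals topology normedtype.
Set Implicit Arguments.
Unset Strict Implicit.
Unset Printing Implicit Defensive.
Import Order.TTheory GRing.Theory Num.Theory numFieldNormedType.Exports.
Local Open Scope classical_set_scope.
Local Open Scope ring_scope.

Notation ratfun F := {fraction {poly F}}.

Section RationalFunctions.
Variable F : fieldType.
Implicit Types (p q : {poly F}) (f : ratfun F).

(* p(x)/q(x); as an element of the field F(x), it is automatically identified
   with its simplified form. *)
Definition mkrf p q : ratfun F := tofrac p / tofrac q.

(* Numerator and denominator in lowest terms: [repr f] need not be reduced, so
   the gcd is divided out. They are determined up to a common nonzero scalar,
   which affects none of the quotients formed below. *)
Definition rf_gcd f : {poly F} := gcdp (repr f).1 (repr f).2.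
Definition rf_num f : {poly F} := (repr f).1 %/ rf_gcd f.
Definition rf_den f : {poly F} := (repr f).2 %/ rf_gcd f.

(* A pole of f is sent to 0, by the convention 0^-1 = 0. *)
Definition rf_eval (x : F) f : F := (rf_num f).[x] / (rf_den f).[x].

Lemma rf_gcd_neq0 f : rf_gcd f != 0.
Proof. by rewrite gcdp_eq0 negb_and denom_ratioP orbT. Qed.

Lemma rf_den_neq0 f : rf_den f != 0.
Proof.
by rewrite dvdp_div_eq0 ?denom_ratioP // dvdp_gcdr.
Qed.

Lemma rf_coprime f : coprimep (rf_num f) (rf_den f).
Proof. by apply: coprimep_div_gcd; rewrite denom_ratioP orbT. Qed.

Lemma rf_numdenE f : mkrf (rf_num f) (rf_den f) = f.
Proof.
have g0 : tofrac (rf_gcd f) != 0 by rewrite tofrac_eq0 rf_gcd_neq0.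
have En : rf_num f * rf_gcd f = (repr f).1 by rewrite divpK ?dvdp_gcdl.
have Ed : rf_den f * rf_gcd f = (repr f).2 by rewrite divpK ?dvdp_gcdr.
have -> : mkrf (rf_num f) (rf_den f) = mkrf (repr f).1 (repr f).2.
  by rewrite -En -Ed /mkrf !tofracM -mulf_div divff // mulr1.
have d0 : tofrac (repr f).2 != 0 by rewrite tofrac_eq0 denom_ratioP.
apply: (mulIf d0); rewrite /mkrf divfK //.
rewrite -{2}[f]reprK; unlock tofrac.
rewrite -[RHS]FracField.pi_mul /FracField.mulf.
apply/eqmodP; rewrite /= FracField.equivfE.
by rewrite !numden_Ratio ?mulf_neq0 ?oner_eq0 ?denom_ratioP // !mulr1 mulrC mul1r.
Qed.

Lemma rf_eval_mkrf (x : F) p q : q.[x] != 0 ->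
  rf_eval x (mkrf p q) = p.[x] / q.[x].
Proof.
move=> qx; set f := mkrf p q.
have q0 : q != 0 by apply: contraNneq qx => ->; rewrite horner0.
have cross : rf_num f * q = p * rf_den f.
  apply/eqP; rewrite -tofrac_eq !tofracM; apply/eqP.
  have := rf_numdenE f; rewrite /f {3}/mkrf -/f /mkrf => /eqP.
  by rewrite eqr_div ?tofrac_eq0 ?rf_den_neq0 // => /eqP.
have /(congr1 (horner^~ x)) := cross; rewrite !hornerM => cx.
have dx : (rf_den f).[x] != 0.
  apply/eqP => dx; move: cx; rewrite dx mulr0 => /eqP.
  rewrite mulf_eq0 (negPf qx) orbF => nx.
  by have := coprimep_root (rf_coprime f) nx; rewrite dx eqxx.
by apply/eqP; rewrite /rf_eval eqr_div // cx.
Qed.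

End RationalFunctions.

Section BackwardTree.
Variable F : fieldType.

Definition Phi0 (f : ratfun F) : ratfun F :=
  let p := rf_num f in let q := rf_den f in
  mkrf (('X - 1) * p + q) (('X + 1) * q - p).

Definition Phi1 (f : ratfun F) : ratfun F :=
  let p := rf_num f in let q := rf_den f in
  mkrf p ('X * q + p).

(* A vertex is the word of left/right moves leading to it from the root: the
   root is [::], and the children of v are rcons v false and rcons v true. *)
Definition vertex := seq bool.

Definition backward_tree (v : vertex) : ratfun F :=
  foldl (fun f b => if b then Phi1 f else Phi0 f) (mkrf 1 ('X + 1)) v.

Definition tree_eval (x0 : F) (v : vertex) : F := rf_eval x0 (backward_tree v).

End BackwardTree.

Definition dense_in (T : topologicalType) (B A : set T) : Prop :=
  A `<=` B /\ B `<=` closure A.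

(* Main.v *)
(* At x = x0 > 0 the two moves act on values y in (0, 1) by increasing maps onto
   (1/(x+1), 1) and (0, 1/(x+1)), the two sides of the root value; this gives
   injectivity.  For x >= 1 the inverse branches expand: an interval of length l
   missing the root pulls back to one of length l' with 1/l' <= 1/l - 1/x, so
   after finitely many steps the root is hit.  For x < 1 the second map has the
   fixed point 1 - x, and no value is <= 1 - x.

   In the coordinate w = x y / (1 - y) the root is 1 and the moves are
   w |-> w + 1 and w |-> w / (x + w).  If x = m is an integer, undoing them on
   w = c/d gives (c - d)/d or m c/(d - c): the denominator never grows, and the
   descent reaches w = 1.  If x = a/b in lowest terms, all values of w have a
   denominator coprime to b, so w = 1/b, that is y = 1/(a+1), is reached only
   when b = 1. *)
Require Import Defs.
From HB Require Import structures.
From mathcomp Require Import all_boot all_order all_algebra.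
From mathcomp Require Import all_classical all_reals topology normedtype.
From mathcomp Require Import ring lra zify.
Import Order.TTheory GRing.Theory Num.Theory numFieldNormedType.Exports.
Local Open Scope classical_set_scope.
Local Open Scope ring_scope.

(** The effect of [Phi1] ([true]) and [Phi0] ([false]) on values at [x]: both are homogeneous in
    numerator and denominator, so only the quotient matters. *)
Definition move {F : fieldType} (x : F) (b : bool) (y : F) : F :=
  if b then y / (x + y) else ((x - 1) * y + 1) / (x + 1 - y).

(** * The two moves as maps of the unit interval *)

Section Moves.
Variables (R : realFieldType) (x : R).
Hypothesis x_gt0 : 0 < x.
Implicit Types (y a b : R) (c : bool) (v : vertex).

Lemma move_true_lt y : 0 < y < 1 -> 0 < move x true y < (x + 1)^-1.
Proof.
have x0 := x_gt0; move=> /andP[y0 y1]; rewrite /move divr_gt0 ?addr_gt0 //=.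
rewrite -[ltRHS]div1r ltr_pdivrMr ?addr_gt0 // mulrAC ltr_pdivlMr ?addr_gt0 //.
by nra.
Qed.

Lemma move_false_gt y : 0 < y < 1 -> (x + 1)^-1 < move x false y < 1.
Proof.
have x0 := x_gt0; move=> /andP[y0 y1]; rewrite /move -[ltLHS]div1r.
rewrite ltr_pdivrMr ?addr_gt0 // mulrAC ltr_pdivlMr ?ltr_pdivrMr; try by lra.
have p : 0 < x * x * y by rewrite !mulr_gt0.
by apply/andP; split; nra.
Qed.

Lemma move_bounds c y : 0 < y < 1 -> 0 < move x c y < 1.
Proof.
have x0 := x_gt0; move=> y01.
have xi0 : 0 < (x + 1)^-1 by rewrite invr_gt0; lra.
have xi1 : (x + 1)^-1 < 1 by rewrite invf_lt1; lra.
by case: c; [have := move_true_lt y y01 | have := move_false_gt y y01]; lra.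
Qed.

Lemma move_true_sub a b : 0 <= a -> 0 <= b ->
  move x true b - move x true a = x * (b - a) / ((x + a) * (x + b)).
Proof. by have x0 := x_gt0; move=> a0 b0; rewrite /move; field; lra. Qed.

Lemma move_false_sub a b : a <= 1 -> b <= 1 ->
  move x false b - move x false a =
  x ^+ 2 * (b - a) / ((x + 1 - a) * (x + 1 - b)).
Proof. by have x0 := x_gt0; move=> a1 b1; rewrite /move; field; lra. Qed.

Lemma move_mono c : {in `[0, 1] &, {mono move x c : a b / a <= b}}.
Proof.
have x0 := x_gt0.
move=> a b; rewrite !in_itv /= => /andP[a0 a1] /andP[b0 b1].
rewrite -subr_ge0 -[RHS]subr_ge0; case: c.
  rewrite move_true_sub // pmulr_lge0 ?pmulr_rge0 //.
  by rewrite invr_gt0 mulr_gt0 //; lra.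
rewrite move_false_sub // pmulr_lge0 ?pmulr_rge0 ?exprn_gt0 //.
by rewrite invr_gt0 mulr_gt0 //; lra.
Qed.

(* For [l] the length of the image and [l'] that of [a, b], this says
   [1 / l >= 1 / l' + 1 / x]. *)
Lemma move_contract c a b : 1 <= x -> 0 <= a -> a <= b -> b <= 1 ->
  (move x c b - move x c a) * (b - a) <=
  x * ((b - a) - (move x c b - move x c a)).
Proof.
move=> x1 a0 ab b1; have x0 := x_gt0; rewrite -subr_ge0; case: c.
  rewrite move_true_sub //; try lra.
  have -> : x * (b - a - x * (b - a) / ((x + a) * (x + b))) -
      x * (b - a) / ((x + a) * (x + b)) * (b - a) =
      x * (b - a) * ((x + a) * (x + b) - x - (b - a)) / ((x + a) * (x + b)).
    by field; lra.
  (* The last factor of the numerator is [x * (x - 1) + (x - 1) * b + (x + 1) * a + a * b],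
     nonnegative since [1 <= x]. *)
  by rewrite divr_ge0 ?mulr_ge0 //; nra.
rewrite move_false_sub //; try lra.
have -> : x * (b - a - x ^+ 2 * (b - a) / ((x + 1 - a) * (x + 1 - b))) -
    x ^+ 2 * (b - a) / ((x + 1 - a) * (x + 1 - b)) * (b - a) =
    x * (b - a) * ((x + 1 - a) * (x + 1 - b) - x ^+ 2 - x * (b - a)) /
    ((x + 1 - a) * (x + 1 - b)).
  by field; lra.
(* Here that factor equals [(1 - b) * (2 * x + 1 - a)]. *)
rewrite divr_ge0 ?mulr_ge0 //; nra.
Qed.

(** Closed intervals, because the endpoints pulled back in [tree_eval_between] may be 0, 1 or the
    root value. *)
Lemma move_true_surj y : 0 <= y <= (x + 1)^-1 ->
  exists2 y', 0 <= y' <= 1 & move x true y' = y.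
Proof.
have x0 := x_gt0; rewrite -div1r ler_pdivlMr; last by lra.
move=> /andP[y0 y1]; have p : 0 < 1 - y by nra.
exists (x * y / (1 - y)).
  apply/andP; split; last by rewrite ler_pdivrMr //; lra.
  by apply: divr_ge0; nra.
by rewrite /move; field; nra.
Qed.

Lemma move_false_surj y : (x + 1)^-1 <= y <= 1 ->
  exists2 y', 0 <= y' <= 1 & move x false y' = y.
Proof.
have x0 := x_gt0; rewrite -div1r ler_pdivrMr; last by lra.
move=> /andP[y0 y1]; have p : 0 < x - 1 + y by nra.
exists (((x + 1) * y - 1) / (x - 1 + y)).
  apply/andP; split; last by rewrite ler_pdivrMr //; nra.
  by apply: divr_ge0; lra.
by rewrite /move; field; nra.
Qed.

(** * Values of the tree: bounds, injectivity, gap, density *)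

Lemma root_eval : tree_eval x [::] = (x + 1)^-1.
Proof.
have x0 := x_gt0; rewrite /tree_eval /= rf_eval_mkrf !hornerE ?div1r //.
by apply/eqP; lra.
Qed.

(* Positivity rules out a pole of the parent, where the junk value is 0. *)
Lemma tree_eval_rcons_bounded v c : 0 < tree_eval x v < 1 ->
  tree_eval x (rcons v c) = move x c (tree_eval x v).
Proof.
rewrite /tree_eval /backward_tree foldl_rcons.
set f := foldl _ _ _ => fx.
have [q0|q0] := eqVneq (rf_den f).[x] 0.
  by move: fx; rewrite /rf_eval q0 invr0 mulr0 ltxx.
have pE : (rf_num f).[x] = rf_eval x f * (rf_den f).[x] by rewrite divfK.
move: (rf_eval x f) fx pE => y /andP[y0 y1] pE.
have x0 := x_gt0.
case: c; rewrite rf_eval_mkrf !hornerE pE -?mulrDl -?mulrBl /move.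
- by rewrite -mulf_div divff // mulr1.
- by rewrite mulf_neq0 //; lra.
- have -> : (x - 1) * (y * (rf_den f).[x]) + (rf_den f).[x] =
    ((x - 1) * y + 1) * (rf_den f).[x] by ring.
  by rewrite -mulf_div divff // mulr1.
- by rewrite mulf_neq0 //; lra.
Qed.

Lemma tree_eval_bounds v : 0 < tree_eval x v < 1.
Proof.
elim/last_ind: v => [|v b IH].
  have x0 := x_gt0.
  by rewrite root_eval invr_gt0 invf_lt1; lra.
by rewrite tree_eval_rcons_bounded // move_bounds.
Qed.

Lemma tree_eval_rcons v c :
  tree_eval x (rcons v c) = move x c (tree_eval x v).
Proof. exact/tree_eval_rcons_bounded/tree_eval_bounds. Qed.

(** The last letter of a nonempty word can be read off its value, so injectivity follows by
    stripping letters from the end. *)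
Lemma tree_eval_lt_root v c : (tree_eval x (rcons v c) < (x + 1)^-1) = c.
Proof.
rewrite tree_eval_rcons; have v01 := tree_eval_bounds v; case: c.
  by have /andP[] := move_true_lt _ v01.
by have /andP[/lt_gtF] := move_false_gt _ v01.
Qed.

Lemma tree_eval_neq_root v c : tree_eval x (rcons v c) != (x + 1)^-1.
Proof.
rewrite tree_eval_rcons; have v01 := tree_eval_bounds v; case: c.
  by have /andP[_ /lt_eqF ->] := move_true_lt _ v01.
by have /andP[/gt_eqF ->] := move_false_gt _ v01.
Qed.

Lemma tree_eval_inj : injective (tree_eval x).
Proof.
have in01 u : tree_eval x u \in `[0, 1].
  by have /andP[u0 u1] := tree_eval_bounds u; rewrite in_itv /= !ltW.
elim/last_ind => [|v b IH] w; case/lastP: w => [//|w c].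
- by rewrite root_eval => /esym /eqP; rewrite (negPf (tree_eval_neq_root w c)).
- by rewrite root_eval => /eqP; rewrite (negPf (tree_eval_neq_root v b)).
move=> e; have bc : b = c.
  by rewrite -(tree_eval_lt_root v b) e tree_eval_lt_root.
move: e; rewrite bc !tree_eval_rcons => e; congr rcons; apply: IH.
exact: (inc_inj_in (move_mono c)) e.
Qed.

(** The move [true] fixes [1 - x] and keeps larger values above it; the root and all values of the
    move [false] are at least [1 / (x + 1)], which exceeds [1 - x] as [(1 - x) * (1 + x) < 1]. *)
Lemma tree_eval_gt_fixpoint v : 1 - x < tree_eval x v.
Proof.
have x0 := x_gt0.
have rgt : 1 - x < (x + 1)^-1 by rewrite -div1r ltr_pdivlMr; nra.
elim/last_ind: v => [|v [] IH]; first by rewrite root_eval.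
  rewrite tree_eval_rcons /move.
  have /andP[y0 y1] := tree_eval_bounds v.
  by rewrite ltr_pdivlMr ?addr_gt0 //; nra.
by apply: lt_le_trans rgt _; rewrite leNgt tree_eval_lt_root.
Qed.

(** The fuel [n] bounds [x / (b - a)], which drops by at least 1 at each pullback. *)
Lemma tree_eval_between (n : nat) a b : 1 <= x ->
  0 <= a -> a < b -> b <= 1 -> x <= n%:R * (b - a) ->
  exists v, a < tree_eval x v < b.
Proof.
move=> x1; elim: n a b => [|n IH] a b a0 ab b1; first by lra.
rewrite -natr1 => hn; have x0 := x_gt0.
have pull c a' b' : 0 <= a' <= 1 -> 0 <= b' <= 1 ->
    move x c a' = a -> move x c b' = b -> exists v, a < tree_eval x v < b.
  move=> a'01 b'01 aE bE.
  have ab' : a' < b' by rewrite -(leW_mono_in (move_mono c)) ?in_itv //= aE bE.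
  have := @move_contract c a' b' x1; rewrite aE bE => hc.
  have [||||v vab] := IH a' b'; try lra.
    (* With l, l' the old and new lengths, [hc] gives x l <= x l' - l l' <= (n + 1) l l' - l l' = n
       l l'. *)
    rewrite -(ler_pM2r (_ : 0 < b - a)) ?subr_gt0 //; nra.
  exists (rcons v c); rewrite tree_eval_rcons -aE -bE.
  have := tree_eval_bounds v => y01.
  by rewrite !(leW_mono_in (move_mono c)) ?in_itv //=; lra.
have [br|rb] := leP b (x + 1)^-1.
  have [|a' a'01 aE] := move_true_surj a; first by lra.
  have [|b' b'01 bE] := move_true_surj b; first by lra.
  exact: pull aE bE.
have [ra|ar] := leP (x + 1)^-1 a; last by exists [::]; rewrite root_eval ar rb.
have [|a' a'01 aE] := move_false_surj a; first by lra.
have [|b' b'01 bE] := move_false_surj b; first by lra.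
exact: pull aE bE.
Qed.

End Moves.

(** * Rational parameters and rational values *)

Section RationalValues.
Variable R : realType.

(** The target is w = c / d, not assumed reduced. Induction is lexicographic in (d, c): undoing
    [true] lowers d while c may grow, undoing [false] keeps d and lowers c. *)
Lemma tree_eval_nat_onto (m c d : nat) : (0 < m)%N -> (0 < c)%N -> (0 < d)%N ->
  exists v, tree_eval (m%:R : R) v = c%:R / (m * d + c)%:R.
Proof.
move=> m0; have M0 : 0 < m%:R :> R by rewrite ltr0n.
elim/ltn_ind: d c => d IHd; elim/ltn_ind => c IHc c0 d0.
have C0 : 0 < c%:R :> R by rewrite ltr0n.
have D0 : 0 < d%:R :> R by rewrite ltr0n.
have MD0 : 0 < m%:R * d%:R :> R by rewrite mulr_gt0.
case: (ltngtP c d) => [cd|dc|<-].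
- have dc : (d - c < d)%N by lia.
  have [||v vE] := IHd _ dc (m * c)%N; try by lia.
  exists (rcons v true); rewrite tree_eval_rcons // vE /move.
  rewrite -mulnDr subnK 1?ltnW // !natrD !natrM; field; lra.
- have [|||v vE] := IHc (c - d)%N; try by lia.
  exists (rcons v false); rewrite tree_eval_rcons // vE /move.
  have DC : 0 < c%:R - d%:R :> R by rewrite subr_gt0 ltr_nat.
  rewrite !natrD !natrM natrB 1?ltnW //; field.
  have MDC : 0 < m%:R * (c%:R - d%:R) :> R by rewrite mulr_gt0.
  have MMD : 0 < m%:R * (m%:R * d%:R) :> R by rewrite mulr_gt0.
  by apply/and3P; split; apply: lt0r_neq0; lra.
- exists [::]; rewrite root_eval // natrD natrM; field; nra.
Qed.

(* In the coordinate w = x y / (1 - y) the value reads w = c / d. *)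
Lemma tree_eval_denominator (a b : nat) v : (0 < a)%N -> (0 < b)%N ->
  coprime a b -> exists c d : nat, [/\ (0 < c)%N, (0 < d)%N, coprime d b &
    tree_eval (a%:R / b%:R : R) v = (b * c)%:R / (a * d + b * c)%:R].
Proof.
move=> a0 b0 ab.
have A0 : 0 < a%:R :> R by rewrite ltr0n.
have B0 : 0 < b%:R :> R by rewrite ltr0n.
have x0 : 0 < a%:R / b%:R :> R by rewrite divr_gt0.
elim/last_ind: v => [|v e [c [d [c0 d0 db vE]]]].
  exists 1%N, 1%N; split; rewrite ?coprime1n // root_eval // !muln1 natrD.
  by field; lra.
have C0 : 0 < c%:R :> R by rewrite ltr0n.
have D0 : 0 < d%:R :> R by rewrite ltr0n.
have BC0 : 0 < b%:R * c%:R :> R by rewrite mulr_gt0.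
have AD0 : 0 < a%:R * d%:R :> R by rewrite mulr_gt0.
case: e.
  exists (b * c)%N, (a * d + b * c)%N; split.
  - by rewrite muln_gt0 b0.
  - by rewrite addn_gt0 !muln_gt0 a0 d0.
  (* Modulo b the new denominator is [a * d], a product of two units. *)
  - rewrite coprime_sym /coprime addnC mulnC gcdnMDl -/(coprime _ _).
    by rewrite coprime_sym coprimeMl ab.
  - by rewrite tree_eval_rcons // vE /move !natrD !natrM; field; nra.
exists (c + d)%N, d; split=> //; first by rewrite addn_gt0 c0.
by rewrite tree_eval_rcons // vE /move !natrD !natrM; field; nra.
Qed.

Lemma rational_natfrac (p q : nat) : @rational R (p%:R / q%:R).
Proof. by apply/rationalP; exists p%:Z, q. Qed.

Lemma pos_rationalP (r : R) : 0 < r -> rational r ->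
  exists p q : nat, [/\ (0 < p)%N, (0 < q)%N, coprime p q & r = p%:R / q%:R].
Proof.
move=> r0 [s _ rE]; move: r0; rewrite -rE ltr0q => s0.
exists `|numq s|%N, `|denq s|%N; split.
- by rewrite absz_gt0 numq_eq0 gt_eqF.
- by rewrite absz_gt0 denq_eq0.
- exact: coprime_num_den.
- rewrite /ratr !natr_absz gtr0_norm ?numq_gt0 // gtr0_norm ?denq_gt0 //.
Qed.

End RationalValues.

Theorem theorem3p1 (R : realType) :
  ((forall x0 : R, 1 <= x0 ->
      injective (tree_eval x0) /\
      dense_in (`]0, 1[ : set R) (range (tree_eval x0)))
   /\
   (forall x0 : R, 0 < x0 < 1 ->
      [/\ injective (tree_eval x0),
          range (tree_eval x0) `<=` `]0, 1[ &
          ~ dense_in (`]0, 1[ : set R) (range (tree_eval x0))]))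
  /\
  (forall x0 : R, 1 <= x0 ->
     (set_bij [set: vertex] (@rational R `&` `]0, 1[) (tree_eval x0)
      <-> exists2 m : nat, (0 < m)%N & x0 = m%:R)).
Proof.
have range01 (x : R) : 0 < x -> range (tree_eval x) `<=` `]0, 1[.
  by move=> x0 _ [v _ <-]; rewrite /= in_itv /=; exact: tree_eval_bounds.
split; first split.
- move=> x x1; have x0 : 0 < x by exact: lt_le_trans x1.
  split; first exact: tree_eval_inj.
  split; first exact: range01.
  move=> y; rewrite /= in_itv /= => /andP[y0 y1] B /nbhs_ballP[e /= e0 eB].
  (* Capping at 1 keeps the interval inside the unit interval. *)
  pose b := Num.min 1 (y + e).
  have yb : y < b by rewrite lt_min y1 ltrDl.
  have [v /andP[yv vb]] : exists v, y < tree_eval x v < b.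
    apply: (@tree_eval_between _ x x0 (Num.truncn (x / (b - y))).+1) => //.
    - exact: ltW.
    - by rewrite ge_min lexx.
    - by rewrite -ler_pdivrMr ?subr_gt0 // ltW // truncnS_gt.
  exists (tree_eval x v); split; first by exists v.
  apply: eB; rewrite /ball /= distrC gtr0_norm ?subr_gt0 // ltrBlDl.
  by move: vb; rewrite lt_min => /andP[].
- move=> x /andP[x0 x1]; split; [exact: tree_eval_inj|exact: range01|].
  move=> [_ dense].
  have /dense : (`]0, 1[%classic : set R) ((1 - x) / 2).
    by rewrite /= in_itv /=; lra.
  have near_gap : nbhs ((1 - x) / 2) (`]0, 1 - x[%classic : set R).
    apply: open_nbhs_nbhs; split; first exact: itv_open.
    by rewrite /= in_itv /=; lra.
  move=> /(_ _ near_gap) [_ [[v _ <-]]]; rewrite /= in_itv /= => /andP[_].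
  by rewrite lt_gtF // tree_eval_gt_fixpoint.
move=> x x1; have x0 : 0 < x by exact: lt_le_trans x1.
split=> [[fun_ev _ surj]|[m m0 xE]].
- have [q0 q1] := fun_ev [::] I; rewrite root_eval // in q0.
  have [a [b [a0 b0 ab xE]]] :
      exists a b : nat, [/\ (0 < a)%N, (0 < b)%N, coprime a b &
        x = a%:R / b%:R].
    apply: pos_rationalP => //; move: q0 => [s _ sE].
    by exists (s^-1 - 1) => //; rewrite rmorphB fmorphV rmorph1 /= sE invrK
      addrK.
  suff b1 : b = 1%N by exists a => //; rewrite xE b1 divr1.
  (* This value has w = 1 / b; equating it with c / d gives d = b c, and d is coprime to b. *)
  have [|v _] := surj (1%:R / a.+1%:R).
    split; first exact: rational_natfrac.
    have a1 : 1 < a.+1%:R :> R by rewrite ltr1n.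
    by rewrite /= in_itv /= div1r invr_gt0 invf_lt1; lra.
  have [c [d [c0 d0 db]]] := tree_eval_denominator R a b v a0 b0 ab.
  rewrite xE => -> /eqP; rewrite eqr_div ?pnatr_eq0 //; last first.
    by rewrite -lt0n addn_gt0 !muln_gt0 a0 d0.
  rewrite -!natrM eqr_nat mul1n mulnS addnC => /eqP e.
  have : (a * d = a * (b * c))%N by lia.
  move/eqP; rewrite eqn_pmul2l // => /eqP dE; move: db.
  by rewrite dE coprimeMl /coprime gcdnn => /andP[/eqP].
- split.
  + move=> v _; split; last by apply: (range01 _ x0); exists v.
    have [||c [d [_ _ _]]] := tree_eval_denominator R m 1 v m0; first by [].
      exact: coprimen1.
    by rewrite divr1 -xE => ->; exact: rational_natfrac.
  + by move=> v w _ _; exact: tree_eval_inj.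
  + move=> y [yrat]; rewrite /= in_itv /= => /andP[y0 y1].
    have [p [q [p0 q0 _ yE]]] := pos_rationalP R y y0 yrat.
    have P0 : 0 < p%:R :> R by rewrite ltr0n.
    have Q0 : 0 < q%:R :> R by rewrite ltr0n.
    have M0 : 0 < m%:R :> R by rewrite ltr0n.
    have pq : (p < q)%N.
      by move: y1; rewrite yE ltr_pdivrMr // mul1r ltr_nat.
    (* For y = p / q the coordinate is w = m p / (q - p). *)
    have [|||v vE] := tree_eval_nat_onto R m (m * p) (q - p).
    * by [].
    * by rewrite muln_gt0 m0.
    * by rewrite subn_gt0.
    exists v => //; rewrite xE vE yE -mulnDr subnK 1?ltnW // !natrM.
    by field; lra.
Qed.
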